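(* Let $-1<\alpha\le0$ and $A\ge a>0$, and let $f:\mathbb{R}\to\mathbb{R}$ and $f_{a,A}$ be as in the context. For $\delta\in\mathbb{R}$ let $u_\delta$ be the unique solution of the Cauchy problem $$-\mathcal{M}^+_{a,A}(u'')\,|u'|^\alpha=f(u)\ \text{ in }\mathbb{R},\qquad u(0)=0,\quad u'(0)=\delta,$$ and let $$\delta_1=\Big((2+\alpha)\int_0^1\frac{f(s)}{a}\,ds\Big)^{\frac1{2+\alpha}}.$$ Then: 1) If $\delta>\delta_1$, then $|u_\delta(x)|\ge C|x|$ for $C=\delta^{2+\alpha}-\delta_1^{2+\alpha}$. In particular $\lim_{x\to\pm\infty}u_\delta(x)=\pm\infty$, and $u_\delta'>0$. 2) If $\delta=\delta_1$, then $u_\delta'>0$ in $\mathbb{R}$, $\lim_{x\to+\infty}u_\delta(x)=1$ and $\lim_{x\to-\infty}u_\delta(x)=-1$. 3) If $-\delta_1\le\delta<\delta_1$, then $|u_\delta(x)|_\infty<1$ for any $x\in\mathbb{R}$. The solution can oscillate. 4) If $\delta<-\delta_1$, then $u_\delta$ is decreasing on $\mathbb{R}$; hence $u_\delta<0$ on $\mathbb{R}^+$ and $u_\delta>0$ on $\mathbb{R}^-$.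
   Context: In dimension one the Pucci operator is $\mathcal{M}^+_{a,A}(s)=As$ if $s\ge0$ and $\mathcal{M}^+_{a,A}(s)=as$ if $s<0$. The notation $|\cdot|_\infty$ is that of the sup norm; $\mathbb{R}^+=(0,+\infty)$ and $\mathbb{R}^-=(-\infty,0)$. Assumptions on $f$: $f\in\mathcal{C}^1([-1,1])$, $f(-1)=f(0)=f(1)=0$, $f>0$ on $(0,1)$, $f<0$ on $(-1,0)$. Define $f_{a,A}(t)=f(t)/a$ if $f(t)>0$, $f_{a,A}(t)=f(t)/A$ if $f(t)<0$, and $f_{a,A}(t)=0$ if $f(t)=0$. It is further assumed that: (i) $f'(\pm1)<0$; (ii) $\int_{-1}^1f_{a,A}(s)\,ds=0$; (iii) $\int_t^1f_{a,A}(s)\,ds>0$ for all $t\in(-1,0]$. Finally $f$ is extended outside $[-1,1]$ so that $f\in\mathcal{C}^{0,1}(\mathbb{R})$, $f\ge0$ on $(-\infty,-1)$, $f\le0$ on $[1,+\infty)$, and $\int_t^1f_{a,A}(s)\,ds>0$ for all $t\in\mathbb{R}\setminus\{\pm1\}$. Solutions. The Cauchy problem can be rewritten as $-u''|u'|^\alpha=f_{a,A}(u)$, $u(0)=0$, $u'(0)=\delta$, and a weak solution of it is a $\mathcal{C}^1$ function $u:\mathbb{R}\to\mathbb{R}$ with $$-\frac{d}{dx}\big(|u'|^\alpha u'\big)=(1+\alpha)f_{a,A}(u)\ \text{ in the distribution sense in }\mathbb{R},\qquad u(0)=0,\ u'(0)=\delta$$ (for $\alpha\le0$ such a solution exists and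 is unique, and weak solutions coincide with viscosity solutions).
   Formalization: In 1) C is (δ^{2+α}−δ_1^{2+α})^{1/(2+α)}, since the printed C fails for large δ; in 3) |u_δ(x)|<1 is pointwise for −δ_1≤δ<δ_1, and the sup norm is <1 only for −δ_1<δ<δ_1, since it equals 1 at δ=−δ_1. *)

(* Defs.v *)
From Stdlib Require Export Reals Lra.
From Coquelicot Require Export Coquelicot.
#[global] Open Scope R_scope.

Definition pucci (a A s : R) : R := if Rle_dec 0 s then A * s else a * s.

Definition f_aA (a A : R) (f : R -> R) (t : R) : R :=
  if Rlt_dec 0 (f t) then f t / a
  else if Rlt_dec (f t) 0 then f t / A
  else 0.

(* Wherever [u'' = s] exists and [|u'|^alpha = p > 0], the equation
   [- pucci (u'') |u'|^alpha = f u] is [- u'' |u'|^alpha = f_aA u]. *)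
Lemma pucci_f_aA (a A : R) (f : R -> R) (s p t : R) :
  0 < a -> a <= A -> 0 < p ->
  (- pucci a A s * p = f t <-> - s * p = f_aA a A f t).
Proof.
intros Ha HA Hp.
assert (HA0 : 0 < A) by lra.
assert (Hia : 0 < / a) by now apply Rinv_0_lt_compat.
assert (HiA : 0 < / A) by now apply Rinv_0_lt_compat.
unfold pucci, f_aA; destruct (Rle_dec 0 s) as [Hs|Hs].
- assert (Hsp : 0 <= s * p) by (apply Rmult_le_pos; lra).
  assert (HAsp : 0 <= A * (s * p)) by (apply Rmult_le_pos; lra).
  destruct (Rlt_dec 0 (f t)) as [H|H]; [|destruct (Rlt_dec (f t) 0) as [H'|H']].
  + assert (0 < f t / a) by now apply Rdiv_lt_0_compat.
    split; intros E; lra.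
  + split; intros E.
    * rewrite <- E; field; lra.
    * apply (f_equal (Rmult A)) in E.
      replace (A * (f t / A)) with (f t) in E by (field; lra); lra.
  + split; intros E.
    * assert (E0 : A * (s * p) = 0) by lra.
      apply Rmult_integral in E0; lra.
    * replace (- (A * s) * p) with (A * (- s * p)) by ring; rewrite E; lra.
- assert (Hsp : 0 < - s * p) by (apply Rmult_lt_0_compat; lra).
  assert (Hasp : 0 < a * (- s * p)) by (apply Rmult_lt_0_compat; lra).
  destruct (Rlt_dec 0 (f t)) as [H|H]; [|destruct (Rlt_dec (f t) 0) as [H'|H']].
  + split; intros E.
    * rewrite <- E; field; lra.
    * apply (f_equal (Rmult a)) in E.
      replace (a * (f t / a)) with (f t) in E by (field; lra); lra.
  + assert (0 < - f t / A) by (apply Rdiv_lt_0_compat; lra).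
    assert (- f t / A = - (f t / A)) by (field; lra).
    split; intros E; lra.
  + split; intros E; lra.
Qed.

(* [D_in] and [continue_in] take limits relative to [-1,1], so the derivatives
   at the end points are one-sided; the extension of [f] to the line need not
   be differentiable there. *)
Record admissible (a A : R) (f : R -> R) : Prop := {
  adm_C1 : let I := fun x => -1 <= x <= 1 in
    exists df : R -> R,
      (forall x, I x -> D_in f df I x /\ continue_in df I x) /\
      df (-1) < 0 /\ df 1 < 0;
  adm_m1 : f (-1) = 0;
  adm_0 : f 0 = 0;
  adm_1 : f 1 = 0;
  adm_pos : forall x, 0 < x < 1 -> 0 < f x;
  adm_neg : forall x, -1 < x < 0 -> f x < 0;
  adm_balance : RInt (f_aA a A f) (-1) 1 = 0;
  adm_int : forall t, -1 < t <= 0 -> 0 < RInt (f_aA a A f) t 1;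
  adm_lip : exists L, forall x y, Rabs (f x - f y) <= L * Rabs (x - y);
  adm_left : forall x, x < -1 -> 0 <= f x;
  adm_right : forall x, 1 <= x -> f x <= 0;
  adm_int_ext : forall t, t <> -1 -> t <> 1 -> 0 < RInt (f_aA a A f) t 1
}.

(* [|p|^alpha p], with value [0] at [p = 0] also for negative [alpha]. *)
Definition spow (alpha p : R) : R := Rpower (Rabs p) alpha * p.

Definition test_function (phi : R -> R) (p q : R) : Prop :=
  (forall n x, ex_derive_n phi n x) /\
  (forall x, x <= p \/ q <= x -> phi x = 0).

(* C^1 solution of [- (|u'|^alpha u')' = (1 + alpha) f_aA (u)] in the
   distribution sense; [phi] vanishes off [p,q], so the pairings over the line
   are integrals over [p,q]. *)
Definition weak_solution (alpha a A : R) (f : R -> R) (delta : R)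
    (u : R -> R) : Prop :=
  (forall x, ex_derive u x /\ continuous (Derive u) x) /\
  (forall phi p q, test_function phi p q ->
     RInt (fun x => spow alpha (Derive u x) * Derive phi x) p q =
     RInt (fun x => (1 + alpha) * f_aA a A f (u x) * phi x) p q) /\
  u 0 = 0 /\ Derive u 0 = delta.

Definition delta1 (alpha a : R) (f : R -> R) : R :=
  Rpower ((2 + alpha) * RInt (fun s => f s / a) 0 1) (1 / (2 + alpha)).

Definition sup_norm (u : R -> R) : Rbar :=
  Lub_Rbar (fun y => exists x, y = Rabs (u x)).

Definition oscillates (u : R -> R) : Prop :=
  forall M,
    (exists x y, M < x /\ M < y /\ u x < 0 < u y) /\
    (exists x y, x < M /\ y < M /\ u x < 0 < u y).

(* Main.v *)
(** Testing the weak equation against differences of smooth steps shows that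
    [v = |u'|^alpha u'] is differentiable with [v' = - (1 + alpha) f_aA u].
    Hence the energy [|u'|^(2+alpha) - (2+alpha) G u] is constant, where
    [G t] is the integral of [f_aA] from [t] to [1]: it is a double-well
    potential, positive except for its zeros [-1] and [1], and
    [d1^(2+alpha) = (2+alpha) G 0].  For [|delta| > d1] the speed is bounded
    below.  For [|delta| = d1] it vanishes only at [u = -1] and [u = 1], which
    cannot be reached because [|u'| = O(|1 -+ u|)] there.  For [|delta| < d1]
    the energy keeps [u] away from [-1] and [1], and a nonzero orbit cannot keep
    a constant sign near infinity. *)

From Stdlib Require Import Lia.
Require Import Defs.

(** * Smooth bump functions *)

(** The equation gives a derivative to [v = |u'|^alpha u'], not to [u'] itself, so the energy is
    differentiated as a function of [v]: [|u'|^(2+alpha) = |v|^(2+b)] with [1 + b = 1/(1+alpha)].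
    This power of [|v|] is differentiable also at [v = 0], hence turning points of [u] need no
    separate treatment. Each estimate is proved near one well and in one direction of time; the
    reflections [u -> -u] and [x -> -x] give the others. Reflecting [u] exchanges the roles of [a]
    and [A] and so leaves the class [a <= A]. For this reason the motion is studied for an abstract
    potential, by axioms stable under the reflection, and the Pucci data enter only at the end. *)

Fixpoint Ck (n : nat) (h : R -> R) : Prop :=
  match n with
  | O => True
  | S m => exists dh, (forall x, is_derive h x (dh x)) /\ Ck m dh
  end.

Lemma Ck_pred n h : Ck (S n) h -> Ck n h.
Proof.
revert h; induction n as [|n IH]; intros h [dh [D C]]; simpl; [exact I|].
exists dh; split; [exact D|]; now apply IH.
Qed.

Lemma Ck_scal n c h : Ck n h -> Ck n (fun x => c * h x).
Proof.
revert h; induction n as [|n IH]; intros h; simpl; [easy|].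
intros [dh [D C]]; exists (fun x => c * dh x); split; [|now apply IH].
intros x; apply (is_derive_scal h x c); apply D.
Qed.

Lemma Ck_plus n h k : Ck n h -> Ck n k -> Ck n (fun x => h x + k x).
Proof.
revert h k; induction n as [|n IH]; intros h k; simpl; [easy|].
intros [dh [D C]] [dk [D' C']]; exists (fun x => dh x + dk x); split.
- intros x; apply (is_derive_plus h k x (dh x) (dk x)); easy.
- now apply IH.
Qed.

Lemma Ck_mult n h k : Ck n h -> Ck n k -> Ck n (fun x => h x * k x).
Proof.
revert h k; induction n as [|n IH]; intros h k; [easy|].
intros H K; pose proof (Ck_pred n h H); pose proof (Ck_pred n k K).
destruct H as [dh [D C]]; destruct K as [dk [D' C']].
exists (fun x => dh x * k x + h x * dk x); split.
- intros x; apply (is_derive_mult h k x (dh x) (dk x)); [easy|easy|].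
  intros; apply Rmult_comm.
- apply Ck_plus; now apply IH.
Qed.

Lemma Ck_comp_affine n c b h : Ck n h -> Ck n (fun x => h (c * x + b)).
Proof.
revert h; induction n as [|n IH]; intros h; [easy|].
intros [dh [D C]]; exists (fun x => c * dh (c * x + b)); split.
- intros x; apply (is_derive_comp h (fun x => c * x + b)); [apply D|].
  auto_derive; [easy|ring].
- apply Ck_scal; now apply IH.
Qed.

(** [Ck] carries a witness for each successive derivative, so its closure properties follow by
    induction without computing any [Derive_n]; the translation into iterated derivatives is made
    only here. *)
Lemma Ck_ex_derive_n h : (forall n, Ck n h) -> forall n x, ex_derive_n h n x.
Proof.
intros H [|n] x; [exact I|].
specialize (H (S n)); revert h x H.
induction n as [|n IH]; intros h x [dh [D C]].
- exists (dh x); apply D.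
- change (ex_derive (Derive_n h (S n)) x).
  apply ex_derive_ext with (Derive_n dh n).
  + intros t; replace (S n) with (n + 1)%nat by lia.
    rewrite <- Derive_n_comp; apply Derive_n_ext; intros s.
    symmetry; apply is_derive_unique, D.
  + now apply IH.
Qed.

(** Meant for [flat] at the origin, where two different formulas meet. *)
Lemma is_derive_quadratic (h : R -> R) (x0 K : R) :
  (forall x, Rabs (h x - h x0) <= K * (x - x0) ^ 2) -> is_derive h x0 0.
Proof.
intros H; apply is_derive_Reals; intros eps Heps.
set (K' := Rabs K + 1); assert (0 < K') by (unfold K'; pose proof (Rabs_pos K); lra).
assert (Hd : 0 < eps / K') by now apply Rdiv_lt_0_compat.
exists (mkposreal _ Hd); simpl; intros t Ht Hlt.
rewrite Rminus_0_r, Rabs_div by easy.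
assert (0 < Rabs t) by now apply Rabs_pos_lt.
apply Rmult_lt_reg_r with (Rabs t); [easy|].
replace (Rabs (h (x0 + t) - h x0) / Rabs t * Rabs t)
  with (Rabs (h (x0 + t) - h x0)) by (field; lra).
apply Rle_lt_trans with (1 := H (x0 + t)).
replace (x0 + t - x0) with t by ring.
rewrite <- (pow2_abs t).
apply Rle_lt_trans with (K' * Rabs t ^ 2).
- apply Rmult_le_compat_r; [apply pow2_ge_0|unfold K'; pose proof (Rle_abs K); lra].
- replace (K' * Rabs t ^ 2) with (K' * Rabs t * Rabs t) by ring.
  apply Rmult_lt_compat_r; [easy|].
  apply Rmult_lt_reg_r with (/ K'); [now apply Rinv_0_lt_compat|].
  replace (K' * Rabs t * / K') with (Rabs t) by (field; lra); exact Hlt.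
Qed.

(* The functions [x^-n exp(-1/x)] are stable under differentiation up to
   linear combinations, which yields smoothness without computing the
   derivatives of [exp(-1/x)]. *)
Definition flat (n : nat) (x : R) : R :=
  if Rlt_dec 0 x then (/ x) ^ n * exp (- / x) else 0.

Lemma flat_pos n x : 0 < x -> 0 < flat n x.
Proof.
intros H; unfold flat; destruct (Rlt_dec 0 x); [|easy].
apply Rmult_lt_0_compat; [|apply exp_pos].
now apply pow_lt, Rinv_0_lt_compat.
Qed.

Lemma flat_0 n x : x <= 0 -> flat n x = 0.
Proof. intros H; unfold flat; destruct (Rlt_dec 0 x); lra. Qed.

Lemma flat_ge_0 n x : 0 <= flat n x.
Proof.
destruct (Rlt_le_dec 0 x) as [H|H]; [now apply Rlt_le, flat_pos|].
rewrite flat_0; lra.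
Qed.

(** Write [exp y] as the [n]-th power of [exp (y / n)], which is at least [y / n]. *)
Lemma pow_le_exp n y : 0 <= y -> y ^ n <= INR n ^ n * exp y.
Proof.
intros Hy; destruct n as [|n].
(* Here [INR 0 ^ 0] is [1], so the claim is [1 <= exp y]. *)
- simpl; pose proof (exp_ineq1_le y); lra.
- set (N := INR (S n)); assert (HN : 0 < N) by (apply lt_0_INR; lia).
  assert (E : exp y = exp (y / N) ^ S n).
  { rewrite <- Rpower_pow by apply exp_pos.
    unfold Rpower; rewrite ln_exp; fold N; f_equal; field; lra. }
  rewrite E, <- Rpow_mult_distr; apply pow_incr; split; [easy|].
  pose proof (exp_ineq1_le (y / N)).
  replace y with (N * (y / N)) at 1 by (field; lra).
  apply Rmult_le_compat_l; lra.
Qed.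

(** Take two extra powers of [1/x] to pay for [x^2]; the exponential absorbs all [n + 2] of them. *)
Lemma flat_quadratic n x : flat n x <= INR (n + 2) ^ (n + 2) * x ^ 2.
Proof.
set (K := INR (n + 2) ^ (n + 2)).
assert (0 <= K) by apply pow_le, pos_INR.
unfold flat; destruct (Rlt_dec 0 x) as [Hx|Hx].
- assert (Hi : 0 < / x) by now apply Rinv_0_lt_compat.
  pose proof (pow_le_exp (n + 2) (/ x) ltac:(lra)) as P; fold K in P.
  assert (Q : (/ x) ^ n = (/ x) ^ (n + 2) * x ^ 2)
    by (rewrite pow_add; field; lra).
  rewrite Q, exp_Ropp.
  assert (0 < exp (/ x)) by apply exp_pos.
  assert (0 < x ^ 2) by now apply pow_lt.
  apply Rmult_le_reg_r with (exp (/ x)); [easy|].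
  replace ((/ x) ^ (n + 2) * x ^ 2 * / exp (/ x) * exp (/ x))
    with ((/ x) ^ (n + 2) * x ^ 2) by (field; lra).
  replace (K * x ^ 2 * exp (/ x)) with (K * exp (/ x) * x ^ 2) by ring.
  apply Rmult_le_compat_r; lra.
- apply Rmult_le_pos; [easy|apply pow2_ge_0].
Qed.

Lemma is_derive_flat n x :
  is_derive (flat n) x (- INR n * flat (n + 1) x + flat (n + 2) x).
Proof.
destruct (Rtotal_order x 0) as [Hx|[->|Hx]].
- rewrite !flat_0 by lra.
  apply is_derive_ext_loc with (fun _ => 0).
  + exists (mkposreal (- x) ltac:(lra)); intros y Hy.
    apply Rabs_lt_between' in Hy; simpl in Hy; rewrite flat_0; lra.
  + replace (- INR n * 0 + 0) with 0 by ring; apply @is_derive_const.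
- rewrite !flat_0 by lra; replace (- INR n * 0 + 0) with 0 by ring.
  apply is_derive_quadratic with (INR (n + 2) ^ (n + 2)); intros x.
  rewrite (flat_0 n 0) by lra; rewrite !Rminus_0_r.
  rewrite Rabs_pos_eq by apply flat_ge_0; apply flat_quadratic.
- apply is_derive_ext_loc with (fun x => (/ x) ^ n * exp (- / x)).
  + exists (mkposreal x Hx); intros y Hy.
    apply Rabs_lt_between' in Hy; simpl in Hy.
    unfold flat; destruct (Rlt_dec 0 y); lra.
  + unfold flat; destruct (Rlt_dec 0 x); [|easy].
    auto_derive; [lra|].
    destruct n as [|n]; [simpl; field; lra|].
    rewrite !pow_add; simpl Init.Nat.pred.
    change ((/ x) ^ S n) with (/ x * (/ x) ^ n); field; lra.
Qed.

Lemma Ck_flat k n : Ck k (flat n).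
Proof.
revert n; induction k as [|k IH]; intros n; [exact I|].
exists (fun x => - INR n * flat (n + 1) x + flat (n + 2) x); split.
- apply is_derive_flat.
- apply Ck_plus; [apply Ck_scal|]; apply IH.
Qed.

(** Smooth and positive exactly on [(-e, e)]. The arguments have the shape [c * x + b] of
    [Ck_comp_affine]. Its integral is left unevaluated, since [two_steps] cancels it. *)
Definition bump (e x : R) : R := flat 0 (1 * x + e) * flat 0 (-1 * x + e).

Lemma Ck_bump e k : Ck k (bump e).
Proof. apply Ck_mult; apply Ck_comp_affine, Ck_flat. Qed.

Lemma bump_ge_0 e x : 0 <= bump e x.
Proof. apply Rmult_le_pos; apply flat_ge_0. Qed.

Lemma bump_pos e x : Rabs x < e -> 0 < bump e x.
Proof.
intros H; apply Rabs_lt_between in H.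
apply Rmult_lt_0_compat; apply flat_pos; lra.
Qed.

Lemma bump_0 e x : e <= Rabs x -> bump e x = 0.
Proof.
intros H; unfold bump; unfold Rabs in H; destruct (Rcase_abs x).
- rewrite (flat_0 0 (1 * x + e)) by lra; ring.
- rewrite (flat_0 0 (-1 * x + e)) by lra; ring.
Qed.

Lemma continuous_bump e x : continuous (bump e) x.
Proof.
destruct (Ck_bump e 1) as [d [D _]].
apply (@ex_derive_continuous R_AbsRing R_NormedModule); exists (d x); apply D.
Qed.

Definition step (e x : R) : R := RInt (bump e) (- e) x.

Lemma ex_RInt_cont (h : R -> R) a b : (forall x, continuous h x) -> ex_RInt h a b.
Proof. intros H; apply (@ex_RInt_continuous R_CompleteNormedModule); auto. Qed.

Lemma is_derive_step e x : is_derive (step e) x (bump e x).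
Proof.
apply (is_derive_RInt (bump e) (step e) (- e) x).
- exists (mkposreal 1 Rlt_0_1); intros y _; apply (@RInt_correct R_CompleteNormedModule).
  apply ex_RInt_cont, continuous_bump.
- apply continuous_bump.
Qed.

Lemma step_left e x : x <= - e -> step e x = 0.
Proof.
intros H; unfold step.
rewrite (RInt_ext _ (fun _ => 0)).
- rewrite RInt_const; apply Rmult_0_r.
- intros t Ht; rewrite Rmin_right, Rmax_left in Ht by easy.
  apply bump_0; pose proof (Rabs_maj2 t); lra.
Qed.

Lemma step_right e x : e <= x -> step e x = step e e.
Proof.
intros H; unfold step.
rewrite <- (RInt_Chasles (bump e) (- e) e x)
  by (apply ex_RInt_cont, continuous_bump).
rewrite (RInt_ext _ (fun _ => 0) e x).
- rewrite RInt_const; unfold scal, plus; simpl; unfold mult; simpl; ring.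
- intros t Ht; rewrite Rmin_left, Rmax_right in Ht by easy.
  apply bump_0; pose proof (Rle_abs t); lra.
Qed.

Lemma Ck_step e k : Ck k (step e).
Proof.
destruct k as [|k]; [exact I|].
exists (bump e); split; [apply is_derive_step|apply Ck_bump].
Qed.

(** * The du Bois-Reymond lemma *)

(** Both steps rise to the same height, so the difference vanishes on either side, and its
    derivative is a bump at [x1] minus an equal bump at [x2]. *)
Definition two_steps (e x1 x2 x : R) : R :=
  step e (1 * x + - x1) + -1 * step e (1 * x + - x2).

Lemma test_function_two_steps e x1 x2 :
  test_function (two_steps e x1 x2) (Rmin x1 x2 - e) (Rmax x1 x2 + e).
Proof.
pose proof (Rmin_l x1 x2); pose proof (Rmin_r x1 x2).
pose proof (Rmax_l x1 x2); pose proof (Rmax_r x1 x2).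
split.
- apply Ck_ex_derive_n; intros n.
  apply Ck_plus; [|apply Ck_scal]; apply Ck_comp_affine, Ck_step.
- intros x [Hx|Hx]; unfold two_steps.
  + rewrite !step_left by lra; ring.
  + rewrite (step_right e (1 * x + - x1)), (step_right e (1 * x + - x2)) by lra; ring.
Qed.

Lemma is_derive_two_steps e x1 x2 x :
  is_derive (two_steps e x1 x2) x (bump e (x - x1) - bump e (x - x2)).
Proof.
assert (D : forall y, is_derive (fun x => step e (1 * x + - y)) x (bump e (x - y))).
{ intros y; replace (x - y) with (1 * x + - y) by ring.
  rewrite <- (Rmult_1_l (bump _ _)).
  apply (is_derive_comp (step e) (fun x => 1 * x + - y)); [apply is_derive_step|].
  auto_derive; [easy|ring]. }
replace (bump e (x - x1) - bump e (x - x2))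
  with (bump e (x - x1) + -1 * bump e (x - x2)) by ring.
unfold two_steps.
apply (is_derive_plus (fun x => step e (1 * x + - x1))
        (fun x => -1 * step e (1 * x + - x2)) x); [apply D|].
apply (is_derive_scal (fun x => step e (1 * x + - x2)) x (-1)); apply D.
Qed.

Lemma continuous_minus_R (h k : R -> R) x :
  continuous h x -> continuous k x -> continuous (fun x => h x - k x) x.
Proof. intros; now apply (@continuous_minus R_UniformSpace R_AbsRing R_NormedModule). Qed.

Lemma continuous_plus_R (h k : R -> R) x :
  continuous h x -> continuous k x -> continuous (fun x => h x + k x) x.
Proof. intros; now apply (@continuous_plus R_UniformSpace R_AbsRing R_NormedModule). Qed.

Lemma continuous_mult_R (h k : R -> R) x :
  continuous h x -> continuous k x -> continuous (fun x => h x * k x) x.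
Proof. intros; now apply (@continuous_mult R_UniformSpace R_AbsRing). Qed.

Lemma is_derive_continuous (h : R -> R) x l : is_derive h x l -> continuous h x.
Proof.
intros H; apply (@ex_derive_continuous R_AbsRing R_NormedModule); now exists l.
Qed.

Lemma continuous_near (h : R -> R) x e : continuous h x -> 0 < e ->
  exists d, 0 < d /\ forall y, Rabs (y - x) < d -> Rabs (h y - h x) < e.
Proof.
intros H He.
destruct (proj1 (filterlim_locally h (h x)) H (mkposreal e He)) as [d Hd].
exists d; split; [apply cond_pos|]; intros y Hy; exact (Hd y Hy).
Qed.

Lemma RInt_pos_at (F : R -> R) p q x0 e :
  0 < e -> p <= x0 - e -> x0 + e <= q ->
  (forall x, continuous F x) -> (forall x, 0 <= F x) ->
  (forall x, Rabs (x - x0) < e -> 0 < F x) -> 0 < RInt F p q.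
Proof.
intros He Hp Hq C P S.
assert (I : forall a b, ex_RInt F a b) by (intros; now apply ex_RInt_cont).
rewrite <- (RInt_Chasles F p (x0 - e) q) by easy.
rewrite <- (RInt_Chasles F (x0 - e) (x0 + e) q) by easy.
assert (0 <= RInt F p (x0 - e)) by now apply RInt_ge_0.
assert (0 <= RInt F (x0 + e) q) by now apply RInt_ge_0.
assert (0 < RInt F (x0 - e) (x0 + e)).
{ apply RInt_gt_0; [lra| |easy].
  intros x Hx; apply S, Rabs_lt_between; lra. }
unfold plus; simpl; lra.
Qed.

(** If [w x1 < w x2], let [c] be the midpoint of the two values. Then [c - w] is positive near [x1],
    where [phi'] is a positive bump, and negative near [x2], where [phi'] is a negative one. So
    [(c - w) phi'] has positive integral, although the test gives [0]. Exchanging the two points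
    shows that [w] is constant. *)
Lemma du_bois_reymond (w : R -> R) :
  (forall x, continuous w x) ->
  (forall phi p q, test_function phi p q ->
     RInt (fun x => w x * Derive phi x) p q = 0) ->
  forall x1 x2, w x2 <= w x1.
Proof.
intros C T x1 x2; apply Rnot_lt_le; intros Hlt.
set (c := (w x1 + w x2) / 2).
destruct (continuous_near w x1 (c - w x1) (C x1)) as [e1 [He1 N1]]; [unfold c; lra|].
destruct (continuous_near w x2 (w x2 - c) (C x2)) as [e2 [He2 N2]]; [unfold c; lra|].
set (e := Rmin e1 e2).
assert (He : 0 < e) by now apply Rmin_glb_lt.
assert (W1 : forall x, Rabs (x - x1) < e -> 0 < c - w x).
{ intros x Hx; specialize (N1 x (Rlt_le_trans _ _ _ Hx (Rmin_l _ _))).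
  apply Rabs_lt_between in N1; lra. }
assert (W2 : forall x, Rabs (x - x2) < e -> 0 < w x - c).
{ intros x Hx; specialize (N2 x (Rlt_le_trans _ _ _ Hx (Rmin_r _ _))).
  apply Rabs_lt_between in N2; lra. }
set (phi := two_steps e x1 x2).
set (b := fun x => bump e (x - x1) - bump e (x - x2)).
set (F := fun x => c * b x - w x * b x).
set (p := Rmin x1 x2 - e); set (q := Rmax x1 x2 + e).
assert (Tphi : test_function phi p q) by apply test_function_two_steps.
assert (D : forall x, is_derive phi x (b x)) by (intros; apply is_derive_two_steps).
assert (Cb : forall x, continuous b x).
{ intros x; apply continuous_minus_R;
  apply (continuous_comp (fun x => x - _) (bump e)); try apply continuous_bump;
  apply continuous_minus_R; [apply continuous_id|apply continuous_const
                            |apply continuous_id|apply continuous_const]. }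
assert (Cc : forall x, continuous (fun x => c * b x) x)
  by (intros; apply continuous_mult_R; [apply continuous_const|apply Cb]).
assert (Cw : forall x, continuous (fun x => w x * b x) x)
  by (intros; apply continuous_mult_R; [apply C|apply Cb]).
(* The constant [c] contributes [c * (phi q - phi p) = 0], the function [w] contributes [0] by
   hypothesis. *)
assert (F0 : RInt F p q = 0).
{ unfold F; rewrite (RInt_minus (fun x => c * b x) (fun x => w x * b x))
    by now apply ex_RInt_cont.
  assert (E : RInt (fun x => c * b x) p q = c * RInt b p q)
    by (apply (RInt_scal b p q c); now apply ex_RInt_cont).
  rewrite E.
  rewrite (RInt_ext (fun x => w x * b x) (fun x => w x * Derive phi x)).
  2: { intros x _; f_equal; symmetry; apply is_derive_unique, D. }
  rewrite (T phi p q Tphi).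
  rewrite (is_RInt_unique b p q _ (is_RInt_derive phi b p q (fun x _ => D x) (fun x _ => Cb x))).
  destruct Tphi as [_ Z].
  rewrite (Z q), (Z p) by lra.
  unfold minus, plus, opp, scal; simpl; unfold mult; simpl; ring. }
assert (Fpos : forall x, 0 <= F x /\ (Rabs (x - x1) < e -> 0 < F x)).
{ intros x.
  (* Grouped by bump, each term is nonnegative: the sign of its factor is known wherever its bump
     does not vanish. *)
  replace (F x) with ((c - w x) * bump e (x - x1) + (w x - c) * bump e (x - x2))
    by (unfold F, b; ring).
  assert (P2 : 0 <= (w x - c) * bump e (x - x2)).
  { destruct (Rlt_le_dec (Rabs (x - x2)) e) as [H|H].
    - apply Rmult_le_pos; [now apply Rlt_le, W2|apply bump_ge_0].
    - rewrite bump_0 by easy; lra. }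
  assert (P1 : Rabs (x - x1) < e -> 0 < (c - w x) * bump e (x - x1)).
  { intros H; apply Rmult_lt_0_compat; [now apply W1|now apply bump_pos]. }
  split; [|intros H; specialize (P1 H); lra].
  destruct (Rlt_le_dec (Rabs (x - x1)) e) as [H|H].
  - specialize (P1 H); lra.
  - rewrite bump_0 by easy; lra. }
assert (0 < RInt F p q).
{ apply RInt_pos_at with x1 e; try easy.
  - unfold p; pose proof (Rmin_l x1 x2); lra.
  - unfold q; pose proof (Rmax_l x1 x2); lra.
  - intros; now apply continuous_minus_R.
  - apply Fpos.
  - intros x; apply Fpos. }
lra.
Qed.

(** With [W] a primitive of [h], integration by parts turns the right side into minus the integral
    of [W phi']. So [v + W] is orthogonal to all [phi'], hence constant. *)
Lemma weak_derivative (v h : R -> R) :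
  (forall x, continuous v x) -> (forall x, continuous h x) ->
  (forall phi p q, test_function phi p q ->
     RInt (fun x => v x * Derive phi x) p q = RInt (fun x => h x * phi x) p q) ->
  forall x, is_derive v x (- h x).
Proof.
intros Cv Ch T.
set (W := fun x => RInt h 0 x).
assert (DW : forall x, is_derive W x (h x)).
{ intros x; apply (is_derive_RInt h W 0 x); [|apply Ch].
  exists (mkposreal 1 Rlt_0_1); intros y _; apply (@RInt_correct R_CompleteNormedModule).
  now apply ex_RInt_cont. }
assert (CW : forall x, continuous W x)
  by (intros x; exact (is_derive_continuous _ _ _ (DW x))).
set (w := fun x => v x + W x).
assert (M : forall x1 x2, w x2 <= w x1).
{ apply du_bois_reymond; [intros; now apply continuous_plus_R|].
  intros phi p q Tphi; pose proof (T phi p q Tphi) as E.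
  destruct Tphi as [S Z].
  assert (D1 : forall x, is_derive phi x (Derive phi x))
    by (intros x; apply Derive_correct, (S 1%nat x)).
  assert (C1 : forall x, continuous phi x)
    by (intros x; exact (is_derive_continuous _ _ _ (D1 x))).
  assert (C2 : forall x, continuous (Derive phi) x).
  { intros x; apply (@ex_derive_continuous R_AbsRing R_NormedModule), (S 2%nat x). }
  assert (I1 : ex_RInt (fun x => v x * Derive phi x) p q)
    by (apply ex_RInt_cont; intros; now apply continuous_mult_R).
  assert (I2 : ex_RInt (fun x => W x * Derive phi x) p q)
    by (apply ex_RInt_cont; intros; now apply continuous_mult_R).
  assert (I3 : ex_RInt (fun x => h x * phi x) p q)
    by (apply ex_RInt_cont; intros; now apply continuous_mult_R).
  rewrite (RInt_ext _ (fun x => v x * Derive phi x + W x * Derive phi x))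
    by (intros; apply Rmult_plus_distr_r).
  rewrite (RInt_plus (fun x => v x * Derive phi x) (fun x => W x * Derive phi x)) by easy.
  rewrite E, <- (RInt_plus (fun x => h x * phi x)) by easy.
  rewrite (is_RInt_unique _ p q (minus (W q * phi q) (W p * phi p))).
  - rewrite (Z q), (Z p) by lra; unfold minus, plus, opp; simpl; ring.
  - apply (is_RInt_derive (fun x => W x * phi x)
             (fun x => h x * phi x + W x * Derive phi x)).
    + intros x _; apply (is_derive_mult W phi x); [apply DW|apply D1|].
      intros; apply Rmult_comm.
    + intros x _; apply continuous_plus_R; now apply continuous_mult_R. }
intros x; apply is_derive_ext with (fun x => w 0 - W x).
- intros t; assert (w t = w 0) by (apply Rle_antisym; apply M).
  unfold w in *; lra.
- replace (- h x) with (0 - h x) by ring.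
  apply (is_derive_minus (fun _ => w 0) W x 0 (h x)); [apply @is_derive_const|apply DW].
Qed.

(** * Signed powers *)

Lemma spow_0 b : spow b 0 = 0.
Proof. apply Rmult_0_r. Qed.

Lemma spow_opp b p : spow b (- p) = - spow b p.
Proof. unfold spow; rewrite Rabs_Ropp; ring. Qed.

Lemma spow_Rpower b p : 0 < p -> spow b p = Rpower p (1 + b).
Proof.
intros H; unfold spow; rewrite Rabs_pos_eq, Rpower_plus, Rpower_1 by lra; ring.
Qed.

Lemma spow_pos b p : 0 < p -> 0 < spow b p.
Proof. intros H; rewrite spow_Rpower by easy; apply exp_pos. Qed.

Lemma spow_neg b p : p < 0 -> spow b p < 0.
Proof.
intros H; pose proof (spow_pos b (- p) ltac:(lra)); rewrite spow_opp in *; lra.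
Qed.

(** The exponents [1 + b] and [1 + c] are reciprocal, so the two odd powers are inverse to each
    other; this recovers [u'] from [v]. *)
Lemma spow_spow b c p : (1 + b) * (1 + c) = 1 -> spow c (spow b p) = p.
Proof.
intros E.
assert (P : forall p, 0 < p -> spow c (spow b p) = p).
{ intros q Hq; rewrite (spow_Rpower c) by now apply spow_pos.
  now rewrite spow_Rpower, Rpower_mult, E, Rpower_1. }
destruct (Rtotal_order p 0) as [H|[->|H]].
- pose proof (P (- p) ltac:(lra)) as Q; rewrite !spow_opp in Q; lra.
- now rewrite !spow_0.
- now apply P.
Qed.

Lemma spow_lt b p q : -1 < b -> p < q -> spow b p < spow b q.
Proof.
intros Hb Hpq.
assert (P : forall p q, 0 < p -> p < q -> spow b p < spow b q).
{ intros p' q' H H'; rewrite !spow_Rpower by lra; apply Rlt_Rpower_l; lra. }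
destruct (Rlt_le_dec 0 p) as [H|H]; [now apply P|].
destruct (Rlt_le_dec 0 q) as [H'|H'].
- destruct (Rle_lt_or_eq_dec p 0 H) as [H0| ->].
  + pose proof (spow_neg b p H0); pose proof (spow_pos b q H'); lra.
  + rewrite spow_0; now apply spow_pos.
- destruct (Rle_lt_or_eq_dec q 0 H') as [H0| ->].
  + pose proof (P (- q) (- p) ltac:(lra) ltac:(lra)) as Q; rewrite !spow_opp in Q; lra.
  + rewrite spow_0; apply spow_neg; lra.
Qed.

Lemma spow_le_inv b p q : -1 < b -> spow b p <= spow b q -> p <= q.
Proof.
intros Hb H; apply Rnot_lt_le; intros H'; pose proof (spow_lt b q p Hb H'); lra.
Qed.

Lemma spow_small b e : -1 < b -> 0 < e ->
  exists d, 0 < d /\ forall p, Rabs p < d -> Rabs (spow b p) < e.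
Proof.
intros Hb He; exists (Rpower e (/ (1 + b))); split; [apply exp_pos|].
intros p Hp.
assert (E : Rabs (spow b p) = spow b (Rabs p)).
{ unfold spow; rewrite Rabs_mult, Rabs_Rabsolu.
  rewrite (Rabs_pos_eq (Rpower _ _)); [easy|apply Rlt_le, exp_pos]. }
rewrite E; apply Rlt_le_trans with (spow b (Rpower e (/ (1 + b)))).
- now apply spow_lt.
- rewrite spow_Rpower, Rpower_mult by apply exp_pos.
  replace (/ (1 + b) * (1 + b)) with 1 by (field; lra).
  rewrite Rpower_1; lra.
Qed.

Lemma locally_pos (P : R -> Prop) p : 0 < p -> (forall y, 0 < y -> P y) -> locally p P.
Proof.
intros H HP; exists (mkposreal p H); intros y Hy.
apply Rabs_lt_between' in Hy; simpl in Hy; apply HP; lra.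
Qed.

Lemma is_derive_Rpower c p : 0 < p ->
  is_derive (fun x => Rpower x c) p (c * Rpower p (c - 1)).
Proof. intros H; apply is_derive_Reals; now apply derivable_pt_lim_power. Qed.

Lemma continuous_spow b p : -1 < b -> continuous (spow b) p.
Proof.
intros Hb.
assert (P : forall p, 0 < p -> continuous (spow b) p).
{ intros q Hq; apply continuous_ext_loc with (fun x => Rpower x (1 + b)).
  - apply locally_pos; [easy|]; intros y Hy; now rewrite spow_Rpower.
  - eapply is_derive_continuous, is_derive_Rpower, Hq. }
destruct (Rtotal_order p 0) as [H|[->|H]].
- apply continuous_ext with (fun x => - spow b (- x)).
  + intros x; rewrite spow_opp; apply Ropp_involutive.
  + apply (@continuous_opp R_UniformSpace R_AbsRing R_NormedModule).
    apply (continuous_comp (fun x => - x) (spow b)).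
    * apply (@continuous_opp R_UniformSpace R_AbsRing R_NormedModule), continuous_id.
    * apply P; lra.
- apply filterlim_locally; intros e.
  destruct (spow_small b e Hb (cond_pos e)) as [d [Hd S]].
  exists (mkposreal d Hd); intros y Hy; change (Rabs (y - 0) < d) in Hy.
  change (Rabs (spow b y - spow b 0) < e).
  rewrite spow_0, Rminus_0_r; apply S; now rewrite Rminus_0_r in Hy.
- now apply P.
Qed.

(* [|p|^(2+b)], with value [0] at [p = 0]. *)
Definition kin (b p : R) : R := spow b p * p.

Lemma kin_opp b p : kin b (- p) = kin b p.
Proof. unfold kin; rewrite spow_opp; ring. Qed.

Lemma kin_0 b : kin b 0 = 0.
Proof. apply Rmult_0_r. Qed.

Lemma kin_Rpower b p : 0 < p -> kin b p = Rpower p (2 + b).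
Proof.
intros H; unfold kin; rewrite spow_Rpower by easy.
replace (2 + b) with (1 + b + 1) by ring.
now rewrite (Rpower_plus (1 + b) 1), Rpower_1.
Qed.

Lemma kin_Rabs b p : kin b (Rabs p) = kin b p.
Proof. unfold Rabs; destruct (Rcase_abs p); [apply kin_opp|easy]. Qed.

Lemma kin_pos b p : p <> 0 -> 0 < kin b p.
Proof.
intros H; rewrite <- kin_Rabs, kin_Rpower; [apply exp_pos|now apply Rabs_pos_lt].
Qed.

Lemma kin_lt b p q : -1 < b -> Rabs p < Rabs q -> kin b p < kin b q.
Proof.
intros Hb H; rewrite <- (kin_Rabs b p), <- (kin_Rabs b q).
pose proof (Rabs_pos p).
destruct (Req_dec (Rabs p) 0) as [->|N].
- rewrite kin_0; apply kin_pos; lra.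
- rewrite !kin_Rpower by lra; apply Rlt_Rpower_l; lra.
Qed.

(** At the origin the difference quotient of [kin b] is [spow b], which tends to [0]; for negative
    [p] use that [kin b] is even. *)
Lemma is_derive_kin b p : -1 < b -> is_derive (kin b) p ((2 + b) * spow b p).
Proof.
intros Hb.
assert (P : forall p, 0 < p -> is_derive (kin b) p ((2 + b) * spow b p)).
{ intros q Hq; apply is_derive_ext_loc with (fun x => Rpower x (2 + b)).
  - apply locally_pos; [easy|]; intros y Hy; now rewrite kin_Rpower.
  - rewrite spow_Rpower by easy.
    replace (1 + b) with (2 + b - 1) by ring; now apply is_derive_Rpower. }
destruct (Rtotal_order p 0) as [H|[->|H]].
- apply is_derive_ext with (fun x => kin b (- x)); [apply kin_opp|].
  replace ((2 + b) * spow b p) with (-1 * ((2 + b) * spow b (- p)))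
    by (rewrite spow_opp; ring).
  apply (is_derive_comp (kin b) (fun x => - x)); [apply P; lra|].
  auto_derive; [easy|ring].
- rewrite spow_0, Rmult_0_r; apply is_derive_Reals; intros e He.
  destruct (spow_small b e Hb He) as [d [Hd S]].
  exists (mkposreal d Hd); intros h Hh Hlt.
  rewrite kin_0, Rplus_0_l, !Rminus_0_r; unfold kin.
  replace (spow b h * h / h) with (spow b h) by (field; easy); now apply S.
- now apply P.
Qed.

(** * Motion in a double well *)

(** Both wells enter alike: [G] is described by its derivative and its two zeros instead of as an
    integral ending at [1], so that [double_well_opp] holds. *)
Record double_well (g G : R -> R) : Prop := {
  dw_lip : exists L, 0 <= L /\ forall x y, Rabs (g x - g y) <= L * Rabs (x - y);
  dw_m1 : g (-1) = 0;
  dw_0 : g 0 = 0;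
  dw_1 : g 1 = 0;
  dw_pos : forall t, 0 < t < 1 -> 0 < g t;
  dw_neg : forall t, -1 < t < 0 -> g t < 0;
  dw_derive : forall t, is_derive G t (- g t);
  dw_Gm1 : G (-1) = 0;
  dw_G1 : G 1 = 0;
  dw_Gpos : forall t, t <> -1 -> t <> 1 -> 0 < G t
}.

(** The derivative is a separate argument, so that the reflected pairs below are trajectories by
    substitution, without rewriting [Derive]. *)
Record trajectory (alpha : R) (g : R -> R) (delta : R) (u du : R -> R) : Prop := {
  tr_derive : forall x, is_derive u x (du x);
  tr_cont : forall x, continuous du x;
  tr_eq : forall x, is_derive (fun y => spow alpha (du y)) x (- ((1 + alpha) * g (u x)));
  tr_0 : u 0 = 0;
  tr_delta : du 0 = delta
}.

Lemma lipschitz_continuous (h : R -> R) L :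
  0 <= L -> (forall x y, Rabs (h x - h y) <= L * Rabs (x - y)) ->
  forall x, continuous h x.
Proof.
intros HL H x; apply filterlim_locally; intros e.
assert (He : 0 < e / (L + 1)) by (apply Rdiv_lt_0_compat; [apply cond_pos|lra]).
exists (mkposreal _ He); intros y Hy; change (Rabs (y - x) < e / (L + 1)) in Hy.
change (Rabs (h y - h x) < e).
apply Rle_lt_trans with (1 := H y x).
apply Rle_lt_trans with ((L + 1) * Rabs (y - x)).
- apply Rmult_le_compat_r; [apply Rabs_pos|lra].
- replace (pos e) with ((L + 1) * (e / (L + 1))) by (field; lra).
  apply Rmult_lt_compat_l; lra.
Qed.

Lemma dw_cont g G : double_well g G -> forall x, continuous g x.
Proof. intros [[L [HL H]] _ _ _ _ _ _ _ _ _]; now apply lipschitz_continuous with L. Qed.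

Lemma is_derive_opp_arg (h : R -> R) l x :
  is_derive h (- x) l -> is_derive (fun y => h (- y)) x (- l).
Proof.
intros H; replace (- l) with (-1 * l) by ring.
apply (is_derive_comp h (fun y => - y)); [exact H|auto_derive; [easy|ring]].
Qed.

Lemma is_derive_opp_R (h : R -> R) l x :
  is_derive h x l -> is_derive (fun y => - h y) x (- l).
Proof. apply (is_derive_opp h x l). Qed.

Lemma continuous_opp_arg (h : R -> R) x : continuous h (- x) -> continuous (fun y => h (- y)) x.
Proof.
intros H; apply (continuous_comp (fun y => - y) h); [|exact H].
apply (@continuous_opp R_UniformSpace R_AbsRing R_NormedModule), continuous_id.
Qed.

Lemma continuous_opp_R (h : R -> R) x : continuous h x -> continuous (fun y => - h y) x.
Proof. apply (@continuous_opp R_UniformSpace R_AbsRing R_NormedModule). Qed.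

Lemma double_well_opp g G :
  double_well g G -> double_well (fun t => - g (- t)) (fun t => G (- t)).
Proof.
intros [[L [HL H]] H1 H0 H2 H3 H4 H5 H6 H7 H8]; split.
- exists L; split; [easy|]; intros x y.
  replace (- g (- x) - - g (- y)) with (g (- y) - g (- x)) by ring.
  replace (x - y) with (- y - - x) by ring; apply H.
- replace (- -1) with 1 by ring; rewrite H2; ring.
- rewrite Ropp_0, H0; ring.
- replace (- (1)) with (-1) by ring; rewrite H1; ring.
- intros t Ht; specialize (H4 (- t) ltac:(lra)); lra.
- intros t Ht; specialize (H3 (- t) ltac:(lra)); lra.
- intros t; apply is_derive_opp_arg, H5.
- now replace (- -1) with 1 by ring.
- now replace (- (1)) with (-1) by ring.
- intros t Ht Ht'; apply H8; lra.
Qed.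

Lemma trajectory_opp alpha g delta u du :
  trajectory alpha g delta u du ->
  trajectory alpha (fun t => - g (- t)) (- delta) (fun x => - u x) (fun x => - du x).
Proof.
intros [H1 H2 H3 H4 H5]; split.
- intros x; apply is_derive_opp_R, H1.
- intros x; apply continuous_opp_R, H2.
- intros x; rewrite Ropp_involutive.
  apply is_derive_ext with (fun y => - spow alpha (du y)).
  + intros t; symmetry; apply spow_opp.
  + replace (- ((1 + alpha) * - g (u x))) with (- - ((1 + alpha) * g (u x))) by ring.
    apply is_derive_opp_R, H3.
- rewrite H4; ring.
- now rewrite H5.
Qed.

(** Reversing time changes the sign of both [v] and its argument, so [v'] keeps its sign and the
    equation is unchanged. *)
Lemma trajectory_rev alpha g delta u du :
  trajectory alpha g delta u du ->
  trajectory alpha g (- delta) (fun x => u (- x)) (fun x => - du (- x)).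
Proof.
intros [H1 H2 H3 H4 H5]; split.
- intros x; apply is_derive_opp_arg, H1.
- intros x; apply continuous_opp_R, continuous_opp_arg, H2.
- intros x; apply is_derive_ext with (fun y => - spow alpha (du (- y))).
  + intros t; symmetry; apply spow_opp.
  + apply is_derive_opp_R.
    rewrite <- (Ropp_involutive ((1 + alpha) * g (u (- x)))).
    apply (is_derive_opp_arg (fun y => spow alpha (du y))), H3.
- now rewrite Ropp_0.
- now rewrite Ropp_0, H5.
Qed.

Lemma mvt_ge (h dh : R -> R) c p q :
  p <= q -> (forall x, is_derive h x (dh x)) ->
  (forall x, p <= x <= q -> c <= dh x) -> c * (q - p) <= h q - h p.
Proof.
intros Hpq D H.
destruct (MVT_gen h p q dh) as [z [Hz E]].
- intros x _; apply D.
- intros x _; apply continuity_pt_filterlim; exact (is_derive_continuous _ _ _ (D x)).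
- rewrite Rmin_left, Rmax_right in Hz by easy.
  rewrite E; apply Rmult_le_compat_r; [lra|now apply H].
Qed.

Lemma mvt_le (h dh : R -> R) c p q :
  p <= q -> (forall x, is_derive h x (dh x)) ->
  (forall x, p <= x <= q -> dh x <= c) -> h q - h p <= c * (q - p).
Proof.
intros Hpq D H.
pose proof (mvt_ge (fun x => - h x) (fun x => - dh x) (- c) p q Hpq
  (fun x => is_derive_opp_R _ _ _ (D x))) as M; simpl in M.
enough (- c * (q - p) <= - h q - - h p) by lra.
apply M; intros x Hx; specialize (H x Hx); lra.
Qed.

Lemma stays_below (h : R -> R) c :
  (forall x, continuous h x) -> (forall x, h x <> c) -> h 0 < c -> forall x, h x < c.
Proof.
intros C N H0 x; apply Rnot_le_lt; intros Hx.
destruct (IVT_gen h 0 x c) as [z [_ Hz]].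
- intros y; apply continuity_pt_filterlim, C.
- rewrite Rmin_left, Rmax_right by lra; lra.
- now apply (N z).
Qed.

(** The mean value theorem gives [G t = - g z * (t - 1)] with [z] between [1] and [t], and [g 1 = 0]
    with the Lipschitz bound gives a second factor [|t - 1|]. *)
Lemma quadratic_bound g G : double_well g G ->
  exists L, 0 <= L /\ forall t, G t <= L * (t - 1) ^ 2.
Proof.
intros W; destruct (dw_lip _ _ W) as [L [HL H]].
exists L; split; [easy|]; intros t.
destruct (MVT_gen G 1 t (fun t => - g t)) as [z [Hz E]].
- intros x _; apply (dw_derive _ _ W).
- intros x _; apply continuity_pt_filterlim.
  exact (is_derive_continuous _ _ _ (dw_derive _ _ W x)).
- rewrite (dw_G1 _ _ W), Rminus_0_r in E; rewrite E.
  pose proof (H z 1) as Hz1; rewrite (dw_1 _ _ W), Rminus_0_r in Hz1.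
  assert (B : Rabs (z - 1) <= Rabs (t - 1)).
  { unfold Rmin, Rmax in Hz; destruct (Rle_dec 1 t);
    unfold Rabs; destruct (Rcase_abs (z - 1)), (Rcase_abs (t - 1)); lra. }
  apply Rle_trans with (1 := Rle_abs _).
  rewrite Rabs_mult, Rabs_Ropp, <- (pow2_abs (t - 1)).
  pose proof (Rabs_pos (t - 1)).
  replace (L * Rabs (t - 1) ^ 2) with (L * Rabs (t - 1) * Rabs (t - 1)) by ring.
  apply Rmult_le_compat_r; [easy|].
  apply Rle_trans with (1 := Hz1); now apply Rmult_le_compat_l.
Qed.

(** Writing the barrier [(2 + alpha) * G 0] as [kin alpha d1] makes the constant of motion the
    excess of the initial energy over the critical one. *)
Lemma energy alpha g G delta d1 u du x :
  -1 < alpha -> double_well g G -> trajectory alpha g delta u du ->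
  kin alpha d1 = (2 + alpha) * G 0 ->
  kin alpha (du x) = kin alpha delta - kin alpha d1 + (2 + alpha) * G (u x).
Proof.
intros Ha W T Hd.
(* The conjugate exponent: [spow b] inverts [spow alpha], and
   [(1 + alpha) * (2 + b) = 2 + alpha]. *)
set (b := - alpha / (1 + alpha)).
assert (Hb : 1 + b = / (1 + alpha)) by (unfold b; field; lra).
assert (0 < / (1 + alpha)) by (apply Rinv_0_lt_compat; lra).
assert (Hab : (1 + alpha) * (1 + b) = 1) by (rewrite Hb; field; lra).
assert (K : forall p, kin b (spow alpha p) = kin alpha p).
{ intros p; unfold kin at 1; rewrite spow_spow by easy; unfold kin; ring. }
set (E := fun x => kin b (spow alpha (du x)) - (2 + alpha) * G (u x)).
assert (D : forall x, is_derive E x 0).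
{ intros y.
  assert (D1 : is_derive (fun x => kin b (spow alpha (du x))) y
    (- ((1 + alpha) * g (u y)) * ((2 + b) * spow b (spow alpha (du y))))).
  { apply (is_derive_comp (kin b) (fun x => spow alpha (du x))).
    - apply is_derive_kin; lra.
    - apply (tr_eq _ _ _ _ _ T). }
  assert (D2 : is_derive (fun x => (2 + alpha) * G (u x)) y
    ((2 + alpha) * (du y * - g (u y)))).
  { apply (is_derive_scal (fun x => G (u x))).
    apply (is_derive_comp G u); [apply (dw_derive _ _ W)|apply (tr_derive _ _ _ _ _ T)]. }
  (* The chain rule leaves the factor [spow b v], which is [u']; the kinetic and potential terms
     then cancel. *)
  rewrite spow_spow in D1 by easy.
  replace 0 with (- ((1 + alpha) * g (u y)) * ((2 + b) * du y)
     - (2 + alpha) * (du y * - g (u y))).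
  - exact (is_derive_minus _ _ _ _ _ D1 D2).
  - replace (2 + b) with (1 + / (1 + alpha)) by lra; field; lra. }
assert (E0 : E x = E 0).
{ destruct (MVT_gen E 0 x (fun _ => 0)) as [z [_ Hz]].
  - intros y _; apply D.
  - intros y _; apply continuity_pt_filterlim; exact (is_derive_continuous _ _ _ (D y)).
  - lra. }
unfold E in E0; rewrite !K, (tr_0 _ _ _ _ _ T), (tr_delta _ _ _ _ _ T) in E0; lra.
Qed.

(** * Orbits above the critical energy *)

Lemma kin_ge alpha E p : -1 < alpha -> 0 < E -> E <= kin alpha p ->
  Rpower E (1 / (2 + alpha)) <= Rabs p.
Proof.
intros Ha HE H; apply Rnot_lt_le; intros H'.
assert (P : 0 < Rpower E (1 / (2 + alpha))) by apply exp_pos.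
rewrite <- (Rabs_pos_eq (Rpower E _)) in H' by lra.
apply (kin_lt alpha) in H'; [|easy].
rewrite (kin_Rpower _ (Rpower _ _)), Rpower_mult in H' by easy.
replace (1 / (2 + alpha) * (2 + alpha)) with 1 in H' by (field; lra).
rewrite Rpower_1 in H'; lra.
Qed.

Lemma positive_of_nonzero (h : R -> R) :
  (forall x, continuous h x) -> (forall x, h x <> 0) -> 0 < h 0 -> forall x, 0 < h x.
Proof.
intros C N H x.
enough (- h x < 0) by lra.
apply (stays_below (fun x => - h x) 0); [intros; now apply continuous_opp_R| |lra].
intros y Hy; apply (N y); lra.
Qed.

Lemma tr_u_cont alpha g delta u du :
  trajectory alpha g delta u du -> forall x, continuous u x.
Proof. intros T x; exact (is_derive_continuous _ _ _ (tr_derive _ _ _ _ _ T x)). Qed.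

Lemma dw_G_ge_0 g G t : double_well g G -> 0 <= G t.
Proof.
intros W; destruct (Req_dec t (-1)) as [->|H1]; [rewrite (dw_Gm1 _ _ W); lra|].
destruct (Req_dec t 1) as [->|H2]; [rewrite (dw_G1 _ _ W); lra|].
now apply Rlt_le, (dw_Gpos _ _ W).
Qed.

(** As [G >= 0], the energy excess bounds [|u'|^(2+alpha)] from below. So [u'] never vanishes and
    keeps the sign of [delta]. *)
Lemma fast_speed alpha g G delta d1 u du :
  -1 < alpha -> double_well g G -> trajectory alpha g delta u du ->
  kin alpha d1 = (2 + alpha) * G 0 -> 0 < d1 < delta ->
  forall x, Rpower (kin alpha delta - kin alpha d1) (1 / (2 + alpha)) <= du x.
Proof.
intros Ha W T Hd Hdd.
assert (HE : 0 < kin alpha delta - kin alpha d1).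
{ pose proof (kin_lt alpha d1 delta Ha) as K; rewrite !Rabs_pos_eq in K by lra; lra. }
set (C := Rpower _ _).
assert (HC : 0 < C) by apply exp_pos.
assert (B : forall x, C <= Rabs (du x)).
{ intros x; apply kin_ge; [easy..|].
  rewrite (energy alpha g G delta d1 u du x) by easy.
  pose proof (dw_G_ge_0 g G (u x) W).
  assert (0 <= (2 + alpha) * G (u x)) by (apply Rmult_le_pos; lra); lra. }
assert (P : forall x, 0 < du x).
{ apply positive_of_nonzero; [apply (tr_cont _ _ _ _ _ T)| |].
  - intros x Hx; specialize (B x); rewrite Hx, Rabs_R0 in B; lra.
  - rewrite (tr_delta _ _ _ _ _ T); lra. }
intros x; specialize (B x); specialize (P x); rewrite Rabs_pos_eq in B; lra.
Qed.

(** * Orbits at the critical energy *)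

Lemma kin_ge_quadratic alpha p B : -1 < alpha <= 0 -> Rabs p <= B ->
  p ^ 2 <= Rpower B (- alpha) * kin alpha p.
Proof.
intros Ha H; destruct (Req_dec p 0) as [->|Hp].
- rewrite kin_0; lra.
- assert (Hp' : 0 < Rabs p) by now apply Rabs_pos_lt.
  rewrite <- (pow2_abs p), <- kin_Rabs, kin_Rpower by easy.
  (* Since [- alpha >= 0], the factor [|p|^(-alpha)] is at most its value at the bound [B]. *)
  replace (Rabs p ^ 2) with (Rpower (Rabs p) (- alpha) * Rpower (Rabs p) (2 + alpha)).
  + apply Rmult_le_compat_r; [apply Rlt_le, exp_pos|].
    apply Rle_Rpower_l; lra.
  + rewrite <- Rpower_plus; replace (- alpha + (2 + alpha)) with (INR 2) by (simpl; ring).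
    now apply Rpower_pow.
Qed.

(* [|u'|^(2+alpha)] is a multiple of [G u = O((1-u)^2)] and [2 + alpha <= 2],
   hence [|u'| = O(|1-u|)] on compact sets and Gronwall's inequality applies. *)
Lemma separatrix_ne_1_right alpha g G delta d1 u du :
  -1 < alpha <= 0 -> double_well g G -> trajectory alpha g delta u du ->
  kin alpha d1 = (2 + alpha) * G 0 -> kin alpha delta = kin alpha d1 ->
  forall x, 0 <= x -> u x <> 1.
Proof.
intros Ha W T Hd Hdd X HX HuX.
destruct (bounded_continuity du 0 X) as [B HB].
{ intros x _; apply (tr_cont _ _ _ _ _ T). }
destruct (quadratic_bound g G W) as [L [HL Q]].
set (K := Rpower B (- alpha) * ((2 + alpha) * L)).
assert (HK : forall x, 0 <= x <= X -> du x ^ 2 <= K * (u x - 1) ^ 2).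
{ intros x Hx.
  apply Rle_trans with (1 := kin_ge_quadratic alpha _ B Ha (Rlt_le _ _ (HB x Hx))).
  rewrite (energy alpha g G delta d1 u du x) by easy.
  unfold K; rewrite Rmult_assoc.
  apply Rmult_le_compat_l; [apply Rlt_le, exp_pos|].
  rewrite Hdd, Rmult_assoc.
  pose proof (Q (u x)).
  assert ((2 + alpha) * G (u x) <= (2 + alpha) * (L * (u x - 1) ^ 2))
    by (apply Rmult_le_compat_l; lra).
  lra. }
(* From [2 (u-1) u' >= - (u-1)^2 - u'^2] and the bound [K], the derivative of [(u-1)^2] is at least
   [- c (u-1)^2]. So [z] is nondecreasing, although [z 0 = 1] and [z X = 0]. *)
set (c := 1 + K).
set (z := fun x => (u x - 1) ^ 2 * exp (c * x)).
set (dz := fun x => (2 * (u x - 1) * du x + c * (u x - 1) ^ 2) * exp (c * x)).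
assert (D : forall x, is_derive z x (dz x)).
{ intros x; pose proof (tr_derive _ _ _ _ _ T x) as Du.
  unfold z, dz; auto_derive; [now exists (du x)|].
  assert (Eu : Derive (fun y : R => u y) x = du x) by now apply is_derive_unique.
  rewrite Eu; ring. }
assert (0 * (X - 0) <= z X - z 0).
{ apply (mvt_ge z dz); [easy..|]; intros x Hx.
  apply Rmult_le_pos; [|apply Rlt_le, exp_pos].
  specialize (HK x Hx); unfold c.
  pose proof (pow2_ge_0 (u x - 1 + du x)).
  replace ((u x - 1 + du x) ^ 2)
    with ((u x - 1) ^ 2 + 2 * (u x - 1) * du x + du x ^ 2) in * by ring.
  lra. }
unfold z in *; rewrite HuX, (tr_0 _ _ _ _ _ T), Rmult_0_r, exp_0 in *; lra.
Qed.

(** The energy condition is even in [delta]: it survives time reversal and covers both [d1] and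
    [- d1]. *)
Lemma separatrix_ne_1 alpha g G delta d1 u du :
  -1 < alpha <= 0 -> double_well g G -> trajectory alpha g delta u du ->
  kin alpha d1 = (2 + alpha) * G 0 -> kin alpha delta = kin alpha d1 ->
  forall x, u x <> 1.
Proof.
intros Ha W T Hd Hdd x; destruct (Rle_lt_dec 0 x) as [Hx|Hx].
- now apply (separatrix_ne_1_right alpha g G delta d1 u du).
- rewrite <- (Ropp_involutive x).
  apply (separatrix_ne_1_right alpha g G (- delta) d1
           (fun x => u (- x)) (fun x => - du (- x))); try easy.
  + now apply trajectory_rev.
  + now rewrite kin_opp.
  + lra.
Qed.

Lemma separatrix_lt_1 alpha g G delta d1 u du :
  -1 < alpha <= 0 -> double_well g G -> trajectory alpha g delta u du ->
  kin alpha d1 = (2 + alpha) * G 0 -> kin alpha delta = kin alpha d1 ->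
  forall x, u x < 1.
Proof.
intros Ha W T Hd Hdd; apply stays_below.
- exact (tr_u_cont _ _ _ _ _ T).
- now apply (separatrix_ne_1 alpha g G delta d1 u du).
- rewrite (tr_0 _ _ _ _ _ T); lra.
Qed.

Lemma separatrix_gt_m1 alpha g G delta d1 u du :
  -1 < alpha <= 0 -> double_well g G -> trajectory alpha g delta u du ->
  kin alpha d1 = (2 + alpha) * G 0 -> kin alpha delta = kin alpha d1 ->
  forall x, -1 < u x.
Proof.
intros Ha W T Hd Hdd x.
enough (- u x < 1) by lra.
apply (separatrix_lt_1 alpha _ _ (- delta) d1 (fun x => - u x) (fun x => - du x) Ha
  (double_well_opp _ _ W) (trajectory_opp _ _ _ _ _ T)).
- now rewrite Ropp_0.
- now rewrite kin_opp.
Qed.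

Lemma separatrix_speed alpha g G d1 u du :
  -1 < alpha <= 0 -> double_well g G -> trajectory alpha g d1 u du ->
  kin alpha d1 = (2 + alpha) * G 0 -> 0 < d1 -> forall x, 0 < du x.
Proof.
intros Ha W T Hd H; apply positive_of_nonzero.
- apply (tr_cont _ _ _ _ _ T).
- intros x Hx.
  pose proof (energy alpha g G d1 d1 u du x ltac:(lra) W T Hd) as E.
  rewrite Hx, kin_0 in E.
  pose proof (separatrix_lt_1 alpha g G d1 d1 u du Ha W T Hd eq_refl x).
  pose proof (separatrix_gt_m1 alpha g G d1 d1 u du Ha W T Hd eq_refl x).
  assert (0 < G (u x)) by (apply (dw_Gpos _ _ W); lra).
  assert (0 < (2 + alpha) * G (u x)) by (apply Rmult_lt_0_compat; lra); lra.
- now rewrite (tr_delta _ _ _ _ _ T).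
Qed.

(** Since [u] increases below [1], the only alternative is that it stays in [[0,b]] for some
    [b < 1]. There [G u >= G b > 0], because [G] is nonincreasing on [[0,b]], and the energy gives a
    positive lower bound for the speed. *)
Lemma separatrix_lim alpha g G d1 u du :
  -1 < alpha <= 0 -> double_well g G -> trajectory alpha g d1 u du ->
  kin alpha d1 = (2 + alpha) * G 0 -> 0 < d1 -> is_lim u p_infty 1.
Proof.
intros Ha W T Hd H.
pose proof (separatrix_speed alpha g G d1 u du Ha W T Hd H) as S.
pose proof (separatrix_lt_1 alpha g G d1 d1 u du Ha W T Hd eq_refl) as U.
assert (M : forall x y, x <= y -> u x <= u y).
{ intros x y Hxy.
  enough (0 * (y - x) <= u y - u x) by lra.
  apply (mvt_ge u du); [easy|apply (tr_derive _ _ _ _ _ T)|].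
  intros; now apply Rlt_le. }
apply is_lim_spec; intros eps; set (b := 1 - eps).
destruct (Classical_Prop.classic (exists X, 0 <= X /\ b < u X)) as [[X [_ HX]]|N].
- exists X; intros x Hx; specialize (M X x ltac:(lra)); specialize (U x).
  apply Rabs_lt_between; unfold b in HX; lra.
- exfalso.
  assert (B : forall x, 0 <= x -> 0 <= u x <= b).
  { intros x Hx; split.
    - rewrite <- (tr_0 _ _ _ _ _ T); now apply M.
    - apply Rnot_lt_le; intros Hb; apply N; now exists x. }
  pose proof (B 0 ltac:(lra)) as B0.
  assert (Hb : b < 1) by (pose proof (cond_pos eps); unfold b; lra).
  assert (HE : 0 < (2 + alpha) * G b)
    by (apply Rmult_lt_0_compat; [lra|apply (dw_Gpos _ _ W); lra]).
  set (c := Rpower ((2 + alpha) * G b) (1 / (2 + alpha))).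
  assert (Hc : 0 < c) by apply exp_pos.
  assert (V : forall x, 0 <= x -> c <= du x).
  { intros x Hx; rewrite <- (Rabs_pos_eq (du x)) by now apply Rlt_le.
    apply kin_ge; [lra|easy|].
    rewrite (energy alpha g G d1 d1 u du x) by (easy || lra).
    enough ((2 + alpha) * G b <= (2 + alpha) * G (u x)) by lra.
    apply Rmult_le_compat_l; [lra|].
    destruct (B x Hx) as [Bx1 Bx2].
    destruct (Req_dec (u x) b) as [->|Hne]; [lra|].
    destruct (MVT_gen G (u x) b (fun t => - g t)) as [z [Hz E]].
    - intros t _; apply (dw_derive _ _ W).
    - intros t _; apply continuity_pt_filterlim.
      exact (is_derive_continuous _ _ _ (dw_derive _ _ W t)).
    - rewrite Rmin_left, Rmax_right in Hz by easy.
      enough (0 <= g z * (b - u x)) by lra.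
      apply Rmult_le_pos; [|lra].
      destruct (Req_dec z 0) as [->|Hz0].
      + rewrite (dw_0 _ _ W); lra.
      + apply Rlt_le, (dw_pos _ _ W); lra. }
  (* At speed at least [c], the level [1] is reached by time [1/c]. *)
  assert (Hi : 0 < / c) by now apply Rinv_0_lt_compat.
  pose proof (mvt_ge u du c 0 (/ c) ltac:(lra) (tr_derive _ _ _ _ _ T)
    ltac:(intros; apply V; lra)) as Z.
  rewrite (tr_0 _ _ _ _ _ T), !Rminus_0_r, Rinv_r in Z by lra.
  specialize (U (/ c)); lra.
Qed.

(** * Orbits below the critical energy *)

Lemma slow_le alpha g G delta d1 u du :
  -1 < alpha <= 0 -> double_well g G -> trajectory alpha g delta u du ->
  kin alpha d1 = (2 + alpha) * G 0 -> Rabs delta < d1 ->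
  exists eta, 0 < eta < 1 /\ forall x, u x < 1 - eta.
Proof.
intros Ha W T Hd H.
destruct (quadratic_bound g G W) as [L [HL Q]].
set (e := kin alpha d1 - kin alpha delta).
assert (He : 0 < e).
{ unfold e; enough (kin alpha delta < kin alpha d1) by lra.
  apply kin_lt; [lra|]; pose proof (Rabs_pos delta); rewrite (Rabs_pos_eq d1); lra. }
(* At the level [1 - eta] the energy would read [|u'|^(2+alpha) = - e + (2 + alpha) * G (1 - eta)].
   The last term is at most [2 * L * eta^2], which this choice keeps below [e / 4], so the level is
   never attained. The summand in [L + 1] keeps the divisor positive if [L = 0]. *)
set (eta := Rmin (1 / 2) (e / (4 * (L + 1)))).
assert (He' : 0 < e / (4 * (L + 1))) by (apply Rdiv_lt_0_compat; lra).
assert (E1 : eta <= 1 / 2) by apply Rmin_l.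
assert (E2 : eta <= e / (4 * (L + 1))) by apply Rmin_r.
assert (E3 : 0 < eta) by (apply Rmin_glb_lt; lra).
assert (E4 : (L + 1) * eta <= e / 4).
{ replace (e / 4) with ((L + 1) * (e / (4 * (L + 1)))) by (field; lra).
  apply Rmult_le_compat_l; lra. }
exists eta; split; [lra|].
apply stays_below; [exact (tr_u_cont _ _ _ _ _ T)| |rewrite (tr_0 _ _ _ _ _ T); lra].
intros x Hx.
pose proof (energy alpha g G delta d1 u du x ltac:(lra) W T Hd) as E.
rewrite Hx in E; fold e in E.
assert (0 <= kin alpha (du x)).
{ destruct (Req_dec (du x) 0) as [->|Hp]; [rewrite kin_0; lra|now apply Rlt_le, kin_pos]. }
pose proof (Q (1 - eta)) as Qe.
replace (1 - eta - 1) with (- eta) in Qe by ring.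
assert (L * (- eta) ^ 2 <= (L + 1) * eta * (1 / 2)).
{ replace (L * (- eta) ^ 2) with (L * eta * eta) by ring.
  apply Rmult_le_compat; try lra; apply Rmult_le_pos; lra. }
pose proof (dw_G_ge_0 g G (1 - eta) W).
assert ((2 + alpha) * G (1 - eta) <= 2 * G (1 - eta)) by (apply Rmult_le_compat_r; lra).
unfold e in *; lra.
Qed.

Lemma slow_bounded alpha g G delta d1 u du :
  -1 < alpha <= 0 -> double_well g G -> trajectory alpha g delta u du ->
  kin alpha d1 = (2 + alpha) * G 0 -> Rabs delta < d1 ->
  exists eta, 0 < eta < 1 /\ forall x, Rabs (u x) <= 1 - eta.
Proof.
intros Ha W T Hd H.
destruct (slow_le alpha g G delta d1 u du Ha W T Hd H) as [e1 [He1 B1]].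
destruct (slow_le alpha _ _ (- delta) d1 (fun x => - u x) (fun x => - du x) Ha
  (double_well_opp _ _ W) (trajectory_opp _ _ _ _ _ T)) as [e2 [He2 B2]].
- now rewrite Ropp_0.
- now rewrite Rabs_Ropp.
- exists (Rmin e1 e2); pose proof (Rmin_l e1 e2); pose proof (Rmin_r e1 e2).
  split; [split; [now apply Rmin_glb_lt|lra]|].
  intros x; specialize (B1 x); specialize (B2 x); apply Rabs_le_between; lra.
Qed.

(* If [u >= 0] near [+oo], then [u' >= 0] there, since otherwise [u' <= c < 0]
   from some point on.  So [u] ends up in a compact subset of [(0,1)], where [g]
   is bounded below, and [|u'|^alpha u'] tends to [-oo]. *)
Lemma slow_negative_right alpha g G delta d1 u du :
  -1 < alpha <= 0 -> double_well g G -> trajectory alpha g delta u du ->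
  kin alpha d1 = (2 + alpha) * G 0 -> Rabs delta < d1 -> delta <> 0 ->
  forall M, exists x, M < x /\ u x < 0.
Proof.
intros Ha W T Hd H Hdelta M.
destruct (slow_bounded alpha g G delta d1 u du Ha W T Hd H) as [eta [Heta B]].
destruct (Classical_Prop.classic (exists x, M < x /\ u x < 0)) as [|N]; [easy|exfalso].
assert (P : forall x, M < x -> 0 <= u x <= 1 - eta).
{ intros x Hx; specialize (B x); apply Rabs_le_between in B; split; [|lra].
  apply Rnot_lt_le; intros Hlt; apply N; now exists x. }
pose proof (tr_derive _ _ _ _ _ T) as Du.
set (v := fun x => spow alpha (du x)).
assert (Dv : forall x, is_derive v x (- ((1 + alpha) * g (u x))))
  by (intros; apply (tr_eq _ _ _ _ _ T)).
assert (Hg : forall t, 0 < t < 1 -> 0 < g t) by apply (dw_pos _ _ W).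
assert (Hg0 : forall t, 0 <= t < 1 -> 0 <= g t).
{ intros t Ht; destruct (Req_dec t 0) as [->|]; [|apply Rlt_le, Hg; lra].
  rewrite (dw_0 _ _ W); lra. }
assert (Mv : forall x y, M < x -> x <= y -> v y <= v x).
{ intros x y Hx Hxy.
  enough (v y - v x <= 0 * (y - x)) by lra.
  apply (mvt_le v (fun x => - ((1 + alpha) * g (u x)))); [easy..|].
  intros z Hz; specialize (P z ltac:(lra)); specialize (Hg0 (u z) ltac:(lra)).
  assert (0 <= (1 + alpha) * g (u z)) by (apply Rmult_le_pos; lra); lra. }
assert (Pdu : forall x, M < x -> 0 <= du x).
{ intros x Hx; apply Rnot_lt_le; intros Hneg.
  (* Long enough for [u] to lose at least one unit, while it must stay in [[0, 1 - eta]]. *)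
  set (y := x + / - du x).
  assert (Hi : 0 < / - du x) by (apply Rinv_0_lt_compat; lra).
  assert (Hy : u y - u x <= du x * (y - x)).
  { apply (mvt_le u du); [unfold y; lra|easy|].
    intros z Hz; apply (spow_le_inv alpha); [lra|]; apply Mv; lra. }
  replace (du x * (y - x)) with (-1) in Hy by (unfold y; field; lra).
  pose proof (P x Hx); pose proof (P y ltac:(unfold y; lra)); lra. }
assert (Mu : forall x y, M < x -> x <= y -> u x <= u y).
{ intros x y Hx Hxy.
  enough (0 * (y - x) <= u y - u x) by lra.
  apply (mvt_ge u du); [easy..|]; intros z Hz; apply Pdu; lra. }
(* Otherwise monotonicity makes [u] vanish on [[M+1, M+2]], giving a point with [u = u' = 0]; there
   the energy forces [kin alpha delta = 0], against [delta <> 0]. *)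
assert (S : 0 < u (M + 2)).
{ destruct (P (M + 2) ltac:(lra)) as [[H2|H2] _]; [easy|exfalso].
  assert (Z : forall x, M + 1 <= x <= M + 2 -> u x = 0).
  { intros x Hx; apply Rle_antisym; [rewrite H2; apply Mu; lra|apply P; lra]. }
  destruct (MVT_gen u (M + 1) (M + 2) du) as [z [Hz E]].
  - intros x _; apply Du.
  - intros x _; apply continuity_pt_filterlim, (tr_u_cont _ _ _ _ _ T).
  - rewrite Rmin_left, Rmax_right in Hz by lra.
    rewrite !Z in E by lra.
    assert (Hz0 : du z = 0) by lra.
    pose proof (energy alpha g G delta d1 u du z ltac:(lra) W T Hd) as En.
    rewrite Hz0, (Z z Hz), kin_0 in En.
    pose proof (kin_pos alpha delta Hdelta); lra. }
set (c := u (M + 2)) in *.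
destruct (continuity_ab_min g c (1 - eta)) as [m [Hm1 Hm2]].
- apply P; lra.
- intros t _; apply continuity_pt_filterlim, (dw_cont _ _ W).
- assert (Hgm : 0 < (1 + alpha) * g m)
    by (apply Rmult_lt_0_compat; [lra|apply Hg; lra]).
  set (k := (1 + alpha) * g m) in *.
  (* As [v' <= - k], after time [r] the value of [v] is at most [-1]. *)
  set (r := (v (M + 2) + 1) / k).
  assert (V2 : 0 <= v (M + 2)).
  { destruct (Pdu (M + 2) ltac:(lra)) as [H2|H2]; unfold v.
    - now apply Rlt_le, spow_pos.
    - rewrite <- H2, spow_0; lra. }
  assert (Hr : 0 < r) by (apply Rdiv_lt_0_compat; lra).
  assert (Hv : v (M + 2 + r) - v (M + 2) <= - k * (M + 2 + r - (M + 2))).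
  { apply (mvt_le v (fun x => - ((1 + alpha) * g (u x)))); [lra|easy|].
    intros z Hz; apply Ropp_le_contravar, Rmult_le_compat_l; [lra|].
    apply Hm1; split; [apply Mu; lra|apply P; lra]. }
  replace (- k * (M + 2 + r - (M + 2))) with (- (v (M + 2) + 1)) in Hv
    by (unfold r; field; lra).
  assert (Hn : v (M + 2 + r) < 0) by lra.
  destruct (Pdu (M + 2 + r) ltac:(lra)) as [H2|H2]; unfold v in Hn.
  + pose proof (spow_pos alpha _ H2); lra.
  + rewrite <- H2, spow_0 in Hn; lra.
Qed.

(** Negative values near [+oo] suffice: applied to [- u] they give positive ones, and time reversal
    covers [-oo]. The claim [R] ranges over all trajectories so that it applies to the reversed
    one. *)
Lemma slow_oscillates alpha g G delta d1 u du :
  -1 < alpha <= 0 -> double_well g G -> trajectory alpha g delta u du ->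
  kin alpha d1 = (2 + alpha) * G 0 -> Rabs delta < d1 -> delta <> 0 -> oscillates u.
Proof.
intros Ha W T Hd H Hdelta M.
assert (R : forall delta u du, trajectory alpha g delta u du -> Rabs delta < d1 ->
  delta <> 0 -> forall M, exists x y, M < x /\ M < y /\ u x < 0 < u y).
{ clear - Ha W Hd; intros delta u du T H Hdelta M.
  destruct (slow_negative_right alpha g G delta d1 u du Ha W T Hd H Hdelta M) as [x [Hx Ux]].
  destruct (slow_negative_right alpha _ _ (- delta) d1 (fun x => - u x) (fun x => - du x) Ha
    (double_well_opp _ _ W) (trajectory_opp _ _ _ _ _ T)) with M as [y [Hy Uy]].
  - now rewrite Ropp_0.
  - now rewrite Rabs_Ropp.
  - lra.
  - exists x, y; repeat split; lra. }
split; [now apply (R delta u du)|].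
destruct (R (- delta) (fun x => u (- x)) (fun x => - du (- x))) with (- M)
  as [x [y [Hx [Hy U]]]].
- now apply trajectory_rev.
- now rewrite Rabs_Ropp.
- lra.
- exists (- x), (- y); repeat split; lra.
Qed.

(** * The Pucci problem *)

Lemma f_aA_pos a A f t : 0 < a -> 0 < f t -> 0 < f_aA a A f t.
Proof.
intros Ha H; unfold f_aA; destruct (Rlt_dec 0 (f t)); [|easy].
now apply Rdiv_lt_0_compat.
Qed.

Lemma f_aA_neg a A f t : 0 < A -> f t < 0 -> f_aA a A f t < 0.
Proof.
intros HA H; unfold f_aA; destruct (Rlt_dec 0 (f t)); [lra|].
destruct (Rlt_dec (f t) 0); [|easy].
enough (0 < - f t / A) by lra; apply Rdiv_lt_0_compat; lra.
Qed.

Lemma f_aA_0 a A f t : f t = 0 -> f_aA a A f t = 0.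
Proof.
intros H; unfold f_aA; rewrite H.
destruct (Rlt_dec 0 0); lra.
Qed.

(** [f_aA] is [f] followed by a piecewise linear map with slopes [1/a] and [1/A], of which [1/a] is
    the larger. *)
Lemma f_aA_lipschitz a A f L : 0 < a <= A ->
  (forall x y, Rabs (f x - f y) <= L * Rabs (x - y)) ->
  forall x y, Rabs (f_aA a A f x - f_aA a A f y) <= L / a * Rabs (x - y).
Proof.
intros Ha H x y.
assert (Hi : / A <= / a) by (apply Rinv_le_contravar; lra).
assert (Hj : 0 < / A) by (apply Rinv_0_lt_compat; lra).
apply Rle_trans with (/ a * Rabs (f x - f y)).
2: { unfold Rdiv; rewrite (Rmult_comm L), Rmult_assoc.
     apply Rmult_le_compat_l; [lra|apply H]. }
rewrite <- (Rabs_pos_eq (/ a)), <- Rabs_mult by lra.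
set (i := / a) in *; set (j := / A) in *.
unfold f_aA, Rdiv; fold i j; generalize (f x), (f y); clear - Hi Hj; intros s t.
(* With [i = 1/a] and [j = 1/A], this fact and the next supply the comparisons of products that
   linear arithmetic cannot find. *)
assert (P : forall r, 0 <= r -> 0 <= j * r <= i * r).
{ intros r Hr; split; [apply Rmult_le_pos; lra|apply Rmult_le_compat_r; lra]. }
assert (Q : forall r, r <= 0 -> i * r <= j * r <= 0).
{ intros r Hr; specialize (P (- r) ltac:(lra)); lra. }
destruct (Rle_lt_dec s t) as [Hst|Hst];
[rewrite (Rabs_minus_sym _ (if Rlt_dec 0 t then _ else _)),
   (Rabs_left1 (i * (s - t))) by (specialize (Q (s - t)); lra);
 pose proof (P (t - s) ltac:(lra))
|rewrite (Rabs_pos_eq (i * (s - t))) by (specialize (P (s - t)); lra);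
 pose proof (P (s - t) ltac:(lra))];
destruct (Rlt_dec 0 s), (Rlt_dec 0 t); try destruct (Rlt_dec s 0);
  try destruct (Rlt_dec t 0);
  try (pose proof (P s ltac:(lra))); try (pose proof (P t ltac:(lra)));
  try (pose proof (Q s ltac:(lra))); try (pose proof (Q t ltac:(lra)));
  try (assert (s = 0) by lra; subst s); try (assert (t = 0) by lra; subst t);
  apply Rabs_le_between; lra.
Qed.

Lemma double_well_f_aA a A f : 0 < a <= A -> admissible a A f ->
  double_well (f_aA a A f) (fun t => RInt (f_aA a A f) t 1).
Proof.
intros Ha F.
assert (Lip : exists L, 0 <= L /\ forall x y,
  Rabs (f_aA a A f x - f_aA a A f y) <= L * Rabs (x - y)).
{ destruct (adm_lip _ _ _ F) as [L HL]; exists (L / a); split.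
  (* The pair [1], [0] shows that the Lipschitz constant is nonnegative. *)
  - pose proof (HL 1 0) as H; rewrite Rminus_0_r, Rabs_R1 in H.
    pose proof (Rabs_pos (f 1 - f 0)).
    apply Rmult_le_pos; [lra|apply Rlt_le, Rinv_0_lt_compat; lra].
  - now apply f_aA_lipschitz. }
split.
- exact Lip.
- apply f_aA_0, (adm_m1 _ _ _ F).
- apply f_aA_0, (adm_0 _ _ _ F).
- apply f_aA_0, (adm_1 _ _ _ F).
- intros t Ht; apply f_aA_pos; [lra|now apply (adm_pos _ _ _ F)].
- intros t Ht; apply f_aA_neg; [lra|now apply (adm_neg _ _ _ F)].
- destruct Lip as [L [HL H]].
  pose proof (lipschitz_continuous _ L HL H) as C.
  intros t; apply (is_derive_RInt' (f_aA a A f) _ t 1); [|apply C].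
  exists (mkposreal 1 Rlt_0_1); intros y _; apply (@RInt_correct R_CompleteNormedModule).
  now apply ex_RInt_cont.
- apply (adm_balance _ _ _ F).
- exact (RInt_point (V := R_CompleteNormedModule) 1 (f_aA a A f)).
- intros t H1 H2; now apply (adm_int_ext _ _ _ F).
Qed.

Lemma weak_solution_trajectory alpha a A f delta u :
  -1 < alpha -> 0 < a <= A -> admissible a A f ->
  weak_solution alpha a A f delta u ->
  trajectory alpha (f_aA a A f) delta u (Derive u).
Proof.
intros Ha HaA F [S [E [E0 E1]]].
assert (D : forall x, is_derive u x (Derive u x))
  by (intros x; apply Derive_correct, (proj1 (S x))).
assert (C : forall x, continuous (Derive u) x) by (intros x; apply S).
split; [easy|easy| |easy|easy].
apply weak_derivative.
- intros x; apply (continuous_comp (Derive u) (spow alpha)); [apply C|].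
  now apply continuous_spow.
- intros x; apply continuous_mult_R; [apply continuous_const|].
  apply (continuous_comp u (f_aA a A f)); [exact (is_derive_continuous _ _ _ (D x))|].
  exact (dw_cont _ _ (double_well_f_aA a A f HaA F) (u x)).
- exact E.
Qed.

Lemma delta1_pos alpha a f : 0 < delta1 alpha a f.
Proof. apply exp_pos. Qed.

(** Between the initial point and the right well [f] is positive, so [f_aA] is [f / a] there; this
    is why [delta1] involves [a] alone. *)
Lemma kin_delta1 alpha a A f : -1 < alpha -> 0 < a <= A -> admissible a A f ->
  kin alpha (delta1 alpha a f) = (2 + alpha) * RInt (f_aA a A f) 0 1.
Proof.
intros Ha HaA F; rewrite kin_Rpower by apply delta1_pos; unfold delta1.
rewrite (RInt_ext (fun s => f s / a) (f_aA a A f)).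
- assert (0 < RInt (f_aA a A f) 0 1) by (apply (adm_int_ext _ _ _ F); lra).
  rewrite Rpower_mult; replace (1 / (2 + alpha) * (2 + alpha)) with 1 by (field; lra).
  apply Rpower_1, Rmult_lt_0_compat; lra.
- intros x Hx; rewrite Rmin_left, Rmax_right in Hx by lra.
  pose proof (adm_pos _ _ _ F x Hx).
  unfold f_aA; now destruct (Rlt_dec 0 (f x)).
Qed.

Lemma linear_growth (u du : R -> R) c :
  (forall x, is_derive u x (du x)) -> u 0 = 0 -> (forall x, c <= du x) ->
  (forall x, 0 <= x -> c * x <= u x) /\ (forall x, x <= 0 -> u x <= c * x).
Proof.
intros D U0 H; split; intros x Hx.
- pose proof (mvt_ge u du c 0 x Hx D (fun x _ => H x)) as M; lra.
- pose proof (mvt_ge u du c x 0 Hx D (fun x _ => H x)) as M; lra.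
Qed.

Theorem proposition5p4 :
  forall (alpha a A : R) (f : R -> R) (u : R -> R -> R),
  -1 < alpha <= 0 ->
  0 < a <= A ->
  admissible a A f ->
  (forall delta : R, weak_solution alpha a A f delta (u delta)) ->
  let d1 := delta1 alpha a f in
  (forall delta : R, d1 < delta ->
     let C := Rpower (Rpower delta (2 + alpha) - Rpower d1 (2 + alpha))
                     (1 / (2 + alpha)) in
     (forall x, C * Rabs x <= Rabs (u delta x)) /\
     is_lim (u delta) p_infty p_infty /\
     is_lim (u delta) m_infty m_infty /\
     (forall x, 0 < Derive (u delta) x)) /\
  ((forall x, 0 < Derive (u d1) x) /\
   is_lim (u d1) p_infty 1 /\
   is_lim (u d1) m_infty (-1)) /\
  ((forall delta : R, - d1 <= delta < d1 ->
      (forall x, Rabs (u delta x) < 1) /\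
      (- d1 < delta -> Rbar_lt (sup_norm (u delta)) 1)) /\
   (exists delta : R, - d1 <= delta < d1 /\ oscillates (u delta))) /\
  (forall delta : R, delta < - d1 ->
     (forall x y, x < y -> u delta y < u delta x) /\
     (forall x, 0 < x -> u delta x < 0) /\
     (forall x, x < 0 -> 0 < u delta x)).
Proof.
intros alpha a A f u Ha HaA F U d1.
set (g := f_aA a A f); set (G := fun t => RInt g t 1).
assert (W : double_well g G) by now apply double_well_f_aA.
assert (T : forall delta, trajectory alpha g delta (u delta) (Derive (u delta))).
{ intros delta; apply weak_solution_trajectory; [lra|easy|easy|apply U]. }
assert (Hd1 : 0 < d1) by apply delta1_pos.
assert (K : kin alpha d1 = (2 + alpha) * G 0) by (apply kin_delta1; [lra|easy|easy]).
split; [|split; [|split]].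
- intros delta Hdelta C.
  assert (V : forall x, C <= Derive (u delta) x).
  (* The energy excess bounds [|u'|^(2+alpha)], so the linear rate [C] is its root of order
     [2 + alpha]. *)
  { unfold C; rewrite <- !kin_Rpower by lra.
    apply (fast_speed alpha g G delta d1 (u delta)); (easy || lra). }
  assert (HC : 0 < C) by apply exp_pos.
  destruct (linear_growth _ _ C (tr_derive _ _ _ _ _ (T delta)) (tr_0 _ _ _ _ _ (T delta)) V)
    as [L1 L2].
  repeat split.
  + intros x; destruct (Rle_lt_dec 0 x) as [Hx|Hx].
    * rewrite (Rabs_pos_eq x) by easy.
      apply Rle_trans with (1 := L1 x Hx), Rle_abs.
    * rewrite (Rabs_left x) by easy.
      pose proof (L2 x ltac:(lra)); pose proof (Rabs_maj2 (u delta x)); lra.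
  + apply is_lim_spec; intros M; exists (Rmax 0 (M / C)); intros x Hx.
    pose proof (Rmax_l 0 (M / C)); pose proof (Rmax_r 0 (M / C)).
    apply Rlt_le_trans with (C * x); [|apply L1; lra].
    replace M with (C * (M / C)) at 1 by (field; lra).
    apply Rmult_lt_compat_l; lra.
  + apply is_lim_spec; intros M; exists (Rmin 0 (M / C)); intros x Hx.
    pose proof (Rmin_l 0 (M / C)); pose proof (Rmin_r 0 (M / C)).
    apply Rle_lt_trans with (C * x); [apply L2; lra|].
    replace M with (C * (M / C)) at 1 by (field; lra).
    apply Rmult_lt_compat_l; lra.
  + intros x; specialize (V x); lra.
- split; [|split].
  + now apply (separatrix_speed alpha g G d1 (u d1)).
  + now apply (separatrix_lim alpha g G d1 (u d1) (Derive (u d1))).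
  (* The map [x -> - u (- x)] again has initial speed [d1], now in the reflected well; its limit [1]
     at [+oo] is the limit [-1] of [u] at [-oo]. *)
  + pose proof (trajectory_opp _ _ _ _ _ (trajectory_rev _ _ _ _ _ (T d1))) as T'.
    rewrite Ropp_involutive in T'.
    assert (K' : kin alpha d1 = (2 + alpha) * G (- 0)) by now rewrite Ropp_0.
    pose proof (separatrix_lim _ _ _ _ _ _ Ha (double_well_opp _ _ W) T' K' Hd1) as L.
    apply is_lim_spec in L; apply is_lim_spec; intros eps.
    destruct (L eps) as [M HM]; exists (- M); intros x Hx.
    specialize (HM (- x) ltac:(lra)); cbv beta in HM; rewrite Ropp_involutive in HM.
    apply Rabs_lt_between in HM; apply Rabs_lt_between; lra.
- split.
  + intros delta Hdelta.
    (* At [- d1] the orbit is a critical one run backwards: it tends to [1] and [-1] at its ends, so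
       its sup norm is [1] and only the strict pointwise bound holds. *)
    destruct (Req_dec delta (- d1)) as [->|Hne].
    * split; [|lra].
      intros x; apply Rabs_lt_between; split.
      -- apply Ropp_lt_cancel; rewrite Ropp_involutive.
         enough (-1 < u (- d1) x) by lra.
         apply (separatrix_gt_m1 alpha g G (- d1) d1 _ (Derive (u (- d1)))); try easy.
         apply kin_opp.
      -- apply (separatrix_lt_1 alpha g G (- d1) d1 _ (Derive (u (- d1)))); try easy.
         apply kin_opp.
    * destruct (slow_bounded alpha g G delta d1 _ _ Ha W (T delta) K) as [eta [Heta B]].
      { apply Rabs_lt_between; lra. }
      split; [intros x; specialize (B x); lra|intros _].
      apply Rbar_le_lt_trans with (1 - eta); [|simpl; lra].
      destruct (Lub_Rbar_correct (fun y => exists x, y = Rabs (u delta x))) as [_ H].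
      apply H; intros y [x ->]; apply B.
  (* Any nonzero speed of modulus less than [d1] would serve; at speed [0] the energy argument for
     oscillation fails. *)
  + exists (d1 / 2); split; [lra|].
    apply (slow_oscillates alpha g G (d1 / 2) d1 _ (Derive (u (d1 / 2)))); try easy.
    * rewrite Rabs_pos_eq; lra.
    * lra.
- intros delta Hdelta.
  (* Reversed in time, the orbit starts with speed [- delta > d1]. *)
  pose proof (fast_speed alpha g G (- delta) d1 _ _ ltac:(lra) W
    (trajectory_rev _ _ _ _ _ (T delta)) K ltac:(lra)) as V.
  set (C := Rpower _ _) in V.
  assert (HC : 0 < C) by apply exp_pos.
  assert (M : forall x y, x < y -> u delta y < u delta x).
  { intros x y Hxy.
    assert (u delta y - u delta x <= - C * (y - x)).
    { apply (mvt_le _ (Derive (u delta))); [lra|apply (tr_derive _ _ _ _ _ (T delta))|].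
      intros z _; specialize (V (- z)); cbv beta in V; rewrite Ropp_involutive in V; lra. }
    assert (0 < C * (y - x)) by (apply Rmult_lt_0_compat; lra); lra. }
  split; [exact M|].
  pose proof (tr_0 _ _ _ _ _ (T delta)) as U0.
  split; intros x Hx; rewrite <- U0; now apply M.
Qed.
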